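(* Let $S=\{(d_0,q_0),\ldots,(d_M,q_M)\}$ be a regular alphabet--base system, with associated numbers $\lambda$ and $\Lambda$. (i) If $x\in\mathbb R$ and $x\notin[\lambda,\Lambda]$, then $x$ has no expansion. (ii) If $x\in[\lambda,\Lambda]$, then $x$ has a lexicographically largest expansion, a lexicographically largest infinite expansion, a lexicographically smallest expansion, and a lexicographically smallest co-infinite expansion.
   Context: Let $M\ge 1$ be an integer. An alphabet--base system is a finite indexed family $S=\{(d_0,q_0),\ldots,(d_M,q_M)\}$ of pairs of real numbers with $q_0,\ldots,q_M>1$. A sequence is an element $(j_i)=j_1j_2\cdots$ of $\{0,\ldots,M\}^{\mathbb N}$, $\mathbb N=\{1,2,\ldots\}$. For a sequence put $\pi((j_i))=\sum_{i=1}^{\infty}\frac{d_{j_i}}{q_{j_1}\cdots q_{j_i}}$ (this series always converges). A sequence $(j_i)$ is an expansion of $x\in\mathbb R$ if $\pi((j_i))=x$. Write $j^\infty$ for the constant sequence $jj\cdots$, so $\pi(j^\infty)=\frac{d_j}{q_j-1}$, and set $\lambda:=\min_j\pi(j^\infty)$, $\Lambda:=\max_j\pi(j^\infty)$. $S$ is regular if $\frac{d_0+\lambda}{q_0}<\frac{d_1+\lambda}{q_1}<\cdots<\frac{d_M+\lambda}{q_M}$, $\frac{d_0+\Lambda}{q_0}<\frac{d_1+\Lambda}{q_1}<\cdots<\frac{d_M+\Lambda}{q_M}$, and $\frac{d_j+\Lambda}{q_j}\ge\frac{d_{j+1}+\lambda}{q_{j+1}}$ for all $j<M$. Lexicographic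 order: $(j_i)\prec(k_i)$ if there is an index $n$ with $j_i=k_i$ for all $i<n$ and $j_n<k_n$. A sequence is finite if it has a last nonzero element $j_n>0$, and infinite otherwise (so $0^\infty$ is infinite). A sequence is co-finite if it has a last element $j_n<M$, and co-infinite otherwise (so $M^\infty$ is co-infinite). *)

(* Defs.v *)
From HB Require Import structures.
From mathcomp Require Import all_boot all_order all_algebra.
From mathcomp Require Import all_classical all_reals all_analysis.
Import numFieldNormedType.Exports.

Set Implicit Arguments.
Unset Strict Implicit.
Unset Printing Implicit Defensive.

Import Order.TTheory GRing.Theory Num.Theory.

Local Open Scope classical_set_scope.
Local Open Scope ring_scope.

Record alphabet_base_system (R : realType) (M : nat) := AlphabetBaseSystem {
  digit : 'I_M.+1 -> R;
  base : 'I_M.+1 -> R;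
  base_gt1 : forall j, 1 < base j }.

(* Sequences over {0, ..., M} are indexed from 0: the letter j_(i+1) of the
   mathematical sequence j_1 j_2 ... is [s i].  The order [<=%O] on this type
   is the lexicographic one, see [word_ltP] below. *)
Notation word M := (big_lexi_order (fun _ : nat => 'I_M.+1)).

Lemma word_ltP (M : nat) (s t : word M) :
  (s < t)%O <-> exists n, (forall i, (i < n)%N -> s i = t i) /\ (s n < t n)%N.
Proof.
have leE (a b : word M) : (a <= b)%O =
    if first_diff a b is Some n then (a n <= b n)%O else true by [].
rewrite lt_neqAle; split.
  move=> /andP[/eqP st]; rewrite leE.
  case E : (first_diff s t) => [n|]; last by case: st; exact/first_diff_NoneP.
  move/first_diff_SomeP : E => [pst nst] lst; exists n; split; first exact: pst.
  by rewrite ltn_neqAle -leEnat; apply/andP; split.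
move=> [n [pst lst]].
have nst : s n != t n by apply: contraTneq lst => ->; rewrite ltnn.
have E : first_diff s t = Some n by apply/first_diff_SomeP.
rewrite leE E; apply/andP; split; last exact: ltnW.
by apply: contra_neq nst => ->.
Qed.

Definition const_word (M : nat) (j : 'I_M.+1) : word M := fun _ => j.

Definition finite_word (M : nat) (s : word M) :=
  exists n, (0 < s n)%N /\ forall i, (n < i)%N -> s i = ord0.

Definition infinite_word (M : nat) (s : word M) := ~ finite_word s.

Definition cofinite_word (M : nat) (s : word M) :=
  exists n, (s n < M)%N /\ forall i, (n < i)%N -> s i = ord_max.

Definition coinfinite_word (M : nat) (s : word M) := ~ cofinite_word s.

Definition largest_in (M : nat) (A : set (word M)) (s : word M) :=
  A s /\ ubound A s.

Definition smallest_in (M : nat) (A : set (word M)) (s : word M) :=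
  A s /\ lbound A s.

Section Expansions.
Variables (R : realType) (M : nat) (S : alphabet_base_system R M).

Definition value_term (s : word M) : R^nat :=
  fun i => digit S (s i) / \prod_(k < i.+1) base S (s k).

(* [limn] is a total operator; [is_cvg_word_value] below shows that the series always
   converges, so that no default value is involved. *)
Definition word_value (s : word M) : R := limn (series (value_term s)).

Lemma is_cvg_word_value (s : word M) : cvgn (series (value_term s)).
Proof.
pose q : R := \big[Num.min/base S ord0]_j base S j.
pose D : R := \sum_j `|digit S j|.
have q_le j : q <= base S j by exact: bigmin_le_cond.
have q_gt1 : 1 < q by apply/bigmin_gtP; split => [|j _]; exact: base_gt1.
have q_gt0 : 0 < q by exact: lt_trans q_gt1.
apply: normed_cvg.
apply: (@series_le_cvg _ _ (geometric D q^-1)) => [i|i|i|].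
- exact: normr_ge0.
- by rewrite /geometric /= mulr_ge0 ?sumr_ge0 ?exprn_ge0 ?invr_ge0 // ltW.
- rewrite /geometric /value_term /= normrM.
  have D_ge : `|digit S (s i)| <= D.
    by rewrite /D (bigD1 (s i)) //= lerDl sumr_ge0.
  have P_ge : q ^+ i <= \prod_(k < i.+1) base S (s k).
    have q_le_prod : q ^+ i.+1 <= \prod_(k < i.+1) base S (s k).
      rewrite -[X in q ^+ X]card_ord -prodr_const.
      by apply: ler_prod => k _; rewrite ltW //=.
    by apply: le_trans q_le_prod; rewrite exprS ler_peMl ?exprn_ge0 // ltW.
  have P_gt0 : 0 < \prod_(k < i.+1) base S (s k).
    by apply: lt_le_trans P_ge; rewrite exprn_gt0.
  apply: ler_pM => //.
  by rewrite normfV gtr0_norm // exprVn lef_pV2 // posrE exprn_gt0.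
- apply: is_cvg_geometric_series.
  by rewrite gtr0_norm ?invr_gt0 // invf_lt1.
Qed.

Definition lambda : R :=
  \big[Num.min/word_value (const_word ord0)]_(j < M.+1) word_value (const_word j).

Definition Lambda : R :=
  \big[Num.max/word_value (const_word ord0)]_(j < M.+1) word_value (const_word j).

Definition regular :=
  [/\ forall j k : 'I_M.+1, k = j.+1 :> nat ->
        (digit S j + lambda) / base S j < (digit S k + lambda) / base S k,
      forall j k : 'I_M.+1, k = j.+1 :> nat ->
        (digit S j + Lambda) / base S j < (digit S k + Lambda) / base S k
    & forall j k : 'I_M.+1, k = j.+1 :> nat ->
        (digit S j + Lambda) / base S j >= (digit S k + lambda) / base S k].

Definition expansion (x : R) : set (word M) := [set s | word_value s = x].

End Expansions.

(* Main.v *)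
(* Every letter acts on remainders by the increasing contraction
   y |-> (d_j + y) / q_j, which maps [lambda, Lambda] into itself; a word expands
   x as soon as successive remainders of x along it stay bounded. For x in
   [lambda, Lambda], always taking the largest letter j with
   (d_j + lambda) / q_j <= remainder keeps the remainder in [lambda, Lambda] and
   gives the largest expansion; with a strict inequality (and the letter 0 if no
   letter qualifies) it gives the largest infinite one, because 0^oo is the only
   expansion of lambda. The smallest expansions come from the mirror system
   {(- d_(M-j), q_(M-j))}, whose lambda is - Lambda. *)
Require Import Defs.
From mathcomp Require Import all_boot all_order all_algebra.
From mathcomp Require Import all_classical all_reals all_analysis.
From mathcomp Require Import lra.
Import Order.TTheory GRing.Theory Num.Theory.
Import numFieldNormedType.Exports.

Set Implicit Arguments.
Unset Strict Implicit.
Unset Printing Implicit Defensive.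

Local Open Scope classical_set_scope.
Local Open Scope ring_scope.

(** * Shifts and mirror images of words *)

Definition shift_word (M : nat) (n : nat) (s : word M) : word M :=
  fun i => s (n + i)%N.

Definition mirror_word (M : nat) (s : word M) : word M :=
  fun i => rev_ord (s i).

Section Words.
Variable M : nat.
Implicit Types s t : word M.

Lemma shift_wordS n s :
  shift_word n.+1 s = shift_word 1 (shift_word n s).
Proof. by apply/funext => i; rewrite /shift_word addnCA. Qed.

Lemma mirror_wordK : involutive (@mirror_word M).
Proof. by move=> s; apply/funext => i; rewrite /mirror_word rev_ordK. Qed.

Lemma lt_mirror_word s t : (s < t)%O -> (mirror_word t < mirror_word s)%O.
Proof.
move=> /word_ltP[n [st ltst]]; apply/word_ltP; exists n; split.
  by move=> i ni; rewrite /mirror_word st.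
by rewrite /= ltn_sub2l// (leq_ltn_trans _ (ltn_ord (t n))).
Qed.

Lemma le_mirror_word s t : (s <= t)%O -> (mirror_word t <= mirror_word s)%O.
Proof.
by rewrite le_eqVlt => /predU1P[->//|/lt_mirror_word/ltW].
Qed.

Lemma finite_mirror_word s : cofinite_word s -> finite_word (mirror_word s).
Proof.
move=> [n [sn sn_max]]; exists n; split; first by rewrite /= subSS subn_gt0.
by move=> i ni; rewrite /mirror_word sn_max//; apply/val_inj; rewrite /= subnn.
Qed.

Lemma cofinite_mirror_word s : finite_word s -> cofinite_word (mirror_word s).
Proof.
move=> [n [sn sn0]]; exists n; split.
  by rewrite /= subSS ltn_subrL sn (leq_trans sn)// -ltnS.
by move=> i ni; rewrite /mirror_word sn0//; apply/val_inj; rewrite /= subSS subn0.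
Qed.

Lemma smallest_in_mirror (A B : set (word M)) s :
  (forall t, A t -> B (mirror_word t)) ->
  (forall t, B t -> A (mirror_word t)) ->
  largest_in A s -> smallest_in B (mirror_word s).
Proof.
move=> AB BA [As sA]; split; first exact: AB.
by move=> t /BA/sA/le_mirror_word; rewrite mirror_wordK.
Qed.

End Words.

(** * Values of words through the branch maps *)

Section Branches.
Variables (R : realType) (M : nat) (S : alphabet_base_system R M).
Implicit Types (s t : word M) (j k : 'I_M.+1) (x y z : R).

Definition branch j y := (digit S j + y) / base S j.

Definition unbranch j x := base S j * x - digit S j.

Lemma base_gt0 j : 0 < base S j.
Proof. exact: lt_trans (base_gt1 S j). Qed.

Lemma unbranchK j : cancel (unbranch j) (branch j).
Proof.
move=> x; rewrite /branch /unbranch addrC subrK mulrAC mulfV ?mul1r//.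
by rewrite gt_eqF// base_gt0.
Qed.

Lemma ler_branch j : {mono branch j : y z / y <= z}.
Proof.
by move=> y z; rewrite /branch ler_pM2r ?invr_gt0 ?base_gt0// lerD2l.
Qed.

Lemma ltr_branch j : {mono branch j : y z / y < z}.
Proof. exact: leW_mono (ler_branch j). Qed.

Lemma branch_inj j : injective (branch j).
Proof. exact: inc_inj (ler_branch j). Qed.

Lemma prod_base_gt0 s n : 0 < \prod_(k < n) base S (s k).
Proof. by apply: prodr_gt0 => k _; exact: base_gt0. Qed.

Lemma word_valueE s : word_value S s = branch (s 0) (word_value S (shift_word 1 s)).
Proof.
apply/cvg_lim => //; rewrite -cvg_shiftS /=.
rewrite (_ : (fun n => _) =
    (fun n => branch (s 0) (series (value_term S (shift_word 1 s)) n))).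
  apply: cvgMl; apply: cvgD; first exact: cvg_cst.
  exact: is_cvg_word_value.
apply/funext => n; rewrite /branch !seriesEord /= big_ord_recl mulrDl.
congr (_ + _); first by rewrite /value_term big_ord1.
rewrite mulr_suml; apply: eq_bigr => i _.
rewrite /value_term /= [in LHS]big_ord_recl /=.
by rewrite invfM mulrA mulrAC.
Qed.

(* The reciprocals of the products are the terms of the series of a word over
   the system with the same bases and all digits equal to 1. *)
Lemma cvg_inv_prod_base s :
  (\prod_(k < n) base S (s k))^-1 @[n --> \oo] --> (0 : R).
Proof.
rewrite -cvg_shiftS /=.
pose T := AlphabetBaseSystem (fun=> 1 : R) (base_gt1 S).
suff <- : value_term T s = fun n => (\prod_(k < n.+1) base S (s k))^-1.
  exact: cvg_series_cvg_0 (@is_cvg_word_value _ _ T s).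
by apply/funext => n; rewrite /value_term div1r.
Qed.

(** The added remainder is squeezed between the constants [a] and [b] over the products, and both
    bounds tend to 0. *)
Lemma cvg_remainder s (z : R^nat) (a b : R) : (forall n, a <= z n <= b) ->
  series (value_term S s) n + z n / \prod_(k < n) base S (s k) @[n --> \oo]
    --> word_value S s.
Proof.
move=> zab; rewrite -[word_value S s]addr0; apply: cvgD.
  exact: is_cvg_word_value.
have cvg0 (c : R) : c / \prod_(k < n) base S (s k) @[n --> \oo] --> (0 : R).
  by rewrite -(mulr0 c); apply: cvgMr; exact: cvg_inv_prod_base.
apply: squeeze_cvgr (cvg0 a) (cvg0 b); near=> n.
by rewrite !ler_pM2r// invr_gt0 prod_base_gt0.
Unshelve. all: by end_near. Qed.

Lemma series_branch s y n :
  series (value_term S s) n.+1 + y / \prod_(k < n.+1) base S (s k) =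
  series (value_term S s) n + branch (s n) y / \prod_(k < n) base S (s k).
Proof.
rewrite !seriesEord /= big_ord_recr /= -addrA; congr (_ + _).
rewrite /value_term /branch -mulrDl -mulrA; congr (_ * _).
by rewrite big_ord_recr /= invfM mulrC.
Qed.

(** By [series_branch], the partial sum plus [z n] over the product does not depend on [n], so its
    limit is its term at 0. *)
Lemma word_value_orbit s (z : R^nat) (a b : R) :
  (forall n, a <= z n <= b) -> (forall n, z n = branch (s n) (z n.+1)) ->
  word_value S s = z 0.
Proof.
move=> zab zE; have := cvg_remainder (s := s) zab.
rewrite (_ : (fun n => _) = (fun=> z 0)) => [/cvg_lim <-//|].
  exact: lim_cst.
apply/funext; elim=> [|n IHn].
  by rewrite seriesEord /= !big_ord0 invr1 mulr1 add0r.
by rewrite series_branch -zE.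
Qed.

Lemma word_value_const j :
  word_value S (const_word j) = digit S j / (base S j - 1).
Proof.
have b1 := base_gt1 S j; set p := word_value _ _.
have fixp : p = branch j p := word_valueE _.
have {}fixp : base S j * p = digit S j + p.
  by rewrite [in LHS]fixp mulrC divfK// gt_eqF// base_gt0.
apply: (@mulIf _ (base S j - 1)).
  by rewrite gt_eqF// subr_gt0.
rewrite divfK; last by rewrite gt_eqF// subr_gt0.
lra.
Qed.

(** The branch of [j] is an increasing contraction fixing the value of [const_word j], so it moves
    every other point towards that value. *)
Lemma le_branch j y : (y <= branch j y) = (y <= word_value S (const_word j)).
Proof.
have b1 := base_gt1 S j; have b0 := base_gt0 j.
rewrite word_value_const /branch ler_pdivlMr// ler_pdivlMr ?subr_gt0//.
by apply/idP/idP; lra.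
Qed.

Lemma lt_branch j y : (y < branch j y) = (y < word_value S (const_word j)).
Proof.
have b1 := base_gt1 S j; have b0 := base_gt0 j.
rewrite word_value_const /branch ltr_pdivlMr// ltr_pdivlMr ?subr_gt0//.
by apply/idP/idP; lra.
Qed.

Lemma lambda_le_branch j : lambda S <= branch j (lambda S).
Proof. by rewrite le_branch bigmin_le. Qed.

(** With remainder [lambda S], the corrected partial sums start at [lambda S] and never decrease,
    since no branch moves [lambda S] down. *)
Lemma lambda_le s : lambda S <= word_value S s.
Proof.
have cv : series (value_term S s) n + lambda S / \prod_(k < n) base S (s k)
    @[n --> \oo] --> word_value S s.
  by apply: (@cvg_remainder _ _ (lambda S) (lambda S)) => n; rewrite lexx.
rewrite -(cvg_lim _ cv)//; apply: limr_ge; first by apply/cvg_ex; eexists; exact: cv.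
apply: nearW; elim=> [|n IHn].
  by rewrite seriesEord /= !big_ord0 invr1 mulr1 add0r.
apply: le_trans IHn _; rewrite series_branch lerD2l ler_pM2r.
  exact: lambda_le_branch.
by rewrite invr_gt0 prod_base_gt0.
Qed.

(** Injective branches cancel along a common prefix; this allows two expansions to be compared at
    their first difference. *)
Lemma eq_word_value_shift s t n :
  word_value S s = word_value S t -> (forall i, (i < n)%N -> s i = t i) ->
  word_value S (shift_word n s) = word_value S (shift_word n t).
Proof.
move=> vst; elim: n => [//|n IHn] st.
have /IHn : forall i, (i < n)%N -> s i = t i by move=> i /ltnW; exact: st.
rewrite word_valueE [RHS]word_valueE -!shift_wordS /shift_word !addn0.
by rewrite (st n (ltnSn n)) => /branch_inj.
Qed.

End Branches.

(** * The mirror system *)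

Definition mirror_system (R : realType) (M : nat)
    (S : alphabet_base_system R M) : alphabet_base_system R M :=
  AlphabetBaseSystem (fun j => - digit S (rev_ord j))
    (fun j => base_gt1 S (rev_ord j)).

Section Mirror.
Variables (R : realType) (M : nat) (S : alphabet_base_system R M).

Lemma word_value_mirror (s : word M) :
  word_value (mirror_system S) s = - word_value S (mirror_word s).
Proof.
rewrite /word_value -limN; last exact: is_cvg_word_value.
congr (limn _); apply/funext => n.
rewrite !fctE !seriesEord /= -sumrN; apply: eq_bigr => i _.
by rewrite /value_term mulNr.
Qed.

Lemma word_value_mirror_const (j : 'I_M.+1) :
  word_value (mirror_system S) (const_word j) =
  - word_value S (const_word (rev_ord j)).
Proof. exact: word_value_mirror. Qed.

Lemma word_value_constE (j : 'I_M.+1) :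
  word_value S (const_word j) =
  - word_value (mirror_system S) (const_word (rev_ord j)).
Proof. by rewrite word_value_mirror_const rev_ordK opprK. Qed.

Lemma lambda_mirror : lambda (mirror_system S) = - Lambda S.
Proof.
apply/le_anti/andP; split.
  by rewrite lerNr; apply: bigmax_le => [|j _];
    rewrite word_value_constE lerN2 bigmin_le.
by apply: le_bigmin => [|j _]; rewrite word_value_mirror_const lerN2 le_bigmax.
Qed.

Lemma Lambda_mirror : Lambda (mirror_system S) = - lambda S.
Proof.
apply/le_anti/andP; split.
  by apply: bigmax_le => [|j _]; rewrite word_value_mirror_const lerN2 bigmin_le.
by rewrite lerNl; apply: le_bigmin => [|j _];
  rewrite word_value_constE lerN2 le_bigmax.
Qed.

Lemma Lambda_ge (s : word M) : word_value S s <= Lambda S.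
Proof.
rewrite -lerN2 -lambda_mirror -(mirror_wordK s) -word_value_mirror.
exact: lambda_le.
Qed.

Lemma branch_mirror (j : 'I_M.+1) (y : R) :
  branch (mirror_system S) j (- y) = - branch S (rev_ord j) y.
Proof. by rewrite /branch /= -opprD mulNr. Qed.

(** Negation and letter reversal each reverse the order: the two strict chains are exchanged and the
    linking inequality goes to itself. *)
Lemma regular_mirror : regular S -> regular (mirror_system S).
Proof.
have revS (j k : 'I_M.+1) : k = j.+1 :> nat -> rev_ord j = (rev_ord k).+1 :> nat.
  by move=> /= kj; rewrite kj subnSK// -kj ltn_ord.
move=> [Sl SL Slink]; split=> j k /revS kj;
  rewrite -/(branch _ j _) -/(branch _ k _) ?lambda_mirror ?Lambda_mirror !branch_mirror.
- by rewrite ltrN2; exact: SL.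
- by rewrite ltrN2; exact: Sl.
- by rewrite lerN2; exact: Slink.
Qed.

End Mirror.

(** * Regular systems and greedy words *)

Section Regular.
Variables (R : realType) (M : nat).
Implicit Types (S : alphabet_base_system R M) (s t : word M) (j : 'I_M.+1).
Implicit Types x : R.

Lemma lambda_lt_branch S j : regular S -> (0 < j)%N ->
  lambda S < branch S j (lambda S).
Proof.
move=> [Sl _ _] j0; have jM : (j.-1 < M.+1)%N by rewrite (leq_ltn_trans (leq_pred j)).
apply: le_lt_trans (lambda_le_branch S (Ordinal jM)) _.
by apply: Sl; rewrite /= prednK.
Qed.

(** A letter [j > 0] moves [lambda S] strictly up, so its fixed point lies above [lambda S]; only
    the letter 0 can attain the minimum. *)
Lemma lambdaE S : regular S -> lambda S = word_value S (const_word ord0).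
Proof.
move=> rS; apply/le_anti; rewrite bigmin_le /= leNgt; apply/negP => l0.
suff : lambda S < lambda S by rewrite ltxx.
rewrite {2}/lambda; apply: lt_bigmin => // j _.
have [j0|j0] := posnP j; last by rewrite -lt_branch lambda_lt_branch.
by rewrite (_ : j = ord0)//; exact/val_inj.
Qed.

Lemma branch_lambda S : regular S -> branch S ord0 (lambda S) = lambda S.
Proof. by move=> /lambdaE ->; rewrite [RHS]word_valueE. Qed.

Lemma branch_Lambda S : regular S -> branch S ord_max (Lambda S) = Lambda S.
Proof.
move=> /regular_mirror/branch_lambda.
rewrite lambda_mirror branch_mirror => /oppr_inj.
by rewrite (_ : rev_ord _ = ord_max)//; apply/val_inj; rewrite /= subSS subn0.
Qed.

(** A first letter above 0 would push the value above [lambda S]. So it is 0, the remainder is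
    [lambda S] again, and the argument repeats. *)
Lemma word_value_lambda S s : regular S ->
  word_value S s = lambda S -> s = const_word ord0.
Proof.
move=> rS.
have step t : word_value S t = lambda S ->
    t 0 = ord0 /\ word_value S (shift_word 1 t) = lambda S.
  rewrite word_valueE => tl; have t0 : t 0 = ord0.
    apply/val_inj/eqP; rewrite /= -leqn0 leqNgt; apply/negP => t0.
    have := lambda_lt_branch rS t0; rewrite -{1}tl ltr_branch ltNge.
    by rewrite lambda_le.
  split=> //; apply: (@branch_inj _ _ S ord0).
  by rewrite branch_lambda// -{1}t0.
move=> sl; have shl n : word_value S (shift_word n s) = lambda S.
  elim: n => [//|n /step[_]]; by rewrite -shift_wordS.
by apply/funext => n; have [] := step _ (shl n); rewrite /shift_word addn0.
Qed.

(* [P x] is the set of letters admissible as first letter of an expansion of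
   [x]. The greedy choice [j] leaves a remainder at most [Lambda S], because the
   next letter is rejected and [branch S j.+1 lambda <= branch S j Lambda]. *)
Lemma greedy_word S (P : R -> pred 'I_M.+1) x : regular S ->
  (forall y, P y ord0) ->
  (forall y j, lambda S <= y -> P y j -> branch S j (lambda S) <= y) ->
  (forall y j, ~~ P y j -> y <= branch S j (lambda S)) ->
  lambda S <= x <= Lambda S ->
  exists2 s, word_value S s = x & forall n,
    P (word_value S (shift_word n s)) (s n) /\
    forall j, P (word_value S (shift_word n s)) j -> (j <= s n)%N.
Proof.
move=> rS P0 Ple Pgt xlL.
pose c y : 'I_M.+1 := [arg max_(j > ord0 | P y j) (j : nat)]%N.
pose z n := iter n (fun y => unbranch S (c y) y) x.
have cP y : P y (c y) /\ forall j, P y j -> (j <= c y)%N.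
  by rewrite /c; case: arg_maxnP => // j Pj jmax; split=> // k /jmax.
have zlL n : lambda S <= z n <= Lambda S.
  elim: n => [//|n]; rewrite [z n.+1]/=; move: (z n) => y /andP[ly yL].
  have [Pc cmax] := cP y.
  (* The bounds are tested after applying the increasing branch of the chosen letter, which sends
     the new remainder back to [y]. *)
  rewrite -(ler_branch S (c y)) -(ler_branch S (c y) _ (Lambda S)) unbranchK.
  rewrite Ple//=; have [cM|Mc] := ltnP (c y) M.
    have nP : ~~ P y (Ordinal (cM : ((c y).+1 < M.+1)%N)).
      by apply/negP => /cmax /=; rewrite ltnn.
    by apply: le_trans (Pgt _ _ nP) _; case: rS => _ _; apply.
  (* The letter [M] has no successor to be rejected, but its branch fixes [Lambda S]. *)
  rewrite (_ : c y = ord_max) ?branch_Lambda//.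
  by apply/val_inj/anti_leq; rewrite /= Mc -ltnS ltn_ord.
pose s : word M := fun n => c (z n).
have zE n : z n = branch S (s n) (z n.+1) by rewrite [z n.+1]/= unbranchK.
have vs n : word_value S (shift_word n s) = z n.
  rewrite -[in RHS](addn0 n).
  apply: (@word_value_orbit _ _ _ _ (fun i => z (n + i)%N) (lambda S) (Lambda S)).
    by move=> i; exact: zlL.
  by move=> i; rewrite addnS -zE.
exists s => [|n]; first exact: (vs 0%N).
by rewrite vs; exact: cP.
Qed.

Lemma largest_expansion S x : regular S -> lambda S <= x <= Lambda S ->
  exists s, largest_in (expansion S x) s.
Proof.
move=> rS xlL.
(* The first disjunct makes 0 admissible for every [y]; for [lambda S <= y] it adds nothing. *)
pose P y := [pred j | (j == ord0) || (branch S j (lambda S) <= y)].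
have [//|y j ly|y j|s sx smax] := @greedy_word S P x rS _ _ _ xlL.
- by move=> /predU1P[->|//]; rewrite branch_lambda.
- by rewrite negb_or -ltNge => /andP[_ /ltW].
(* At the first difference both words have the same remainder, and the letter of [t] is admissible
   for it, so it cannot exceed the greedy one. *)
exists s; split=> // t tx; rewrite leNgt; apply/negP => /word_ltP[n [st ltst]].
have [_] := smax n; move=> /(_ (t n)); rewrite leqNgt ltst.
rewrite (eq_word_value_shift _ st) ?sx ?tx// word_valueE /shift_word addn0.
by rewrite /= ler_branch lambda_le orbT => /(_ isT).
Qed.

Lemma largest_infinite_expansion S x : regular S -> lambda S <= x <= Lambda S ->
  exists s, largest_in (expansion S x `&` [set t | infinite_word t]) s.
Proof.
move=> rS xlL.
(* At [y = lambda S] no letter passes the strict test, and the first disjunct supplies 0. *)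
pose P y := [pred j | (j == ord0) || (branch S j (lambda S) < y)].
have [//|y j ly|y j|s sx smax] := @greedy_word S P x rS _ _ _ xlL.
- by move=> /predU1P[->|/ltW//]; rewrite branch_lambda.
- by rewrite negb_or -leNgt => /andP[].
exists s; split.
  split=> // -[n [sn sn0]].
  (* After a last nonzero letter the remainder is the value of [const_word ord0], which is
     [lambda S]; the strict test then fails and forces [s n] to be 0. *)
  have [+ _] := smax n; rewrite word_valueE /= /shift_word addn0.
  rewrite ltr_branch (_ : (fun i => _) = const_word ord0).
    by rewrite -lambdaE// ltxx orbF => /eqP s0; rewrite s0 in sn.
  by apply/funext => i; rewrite sn0// addnA addn1 leq_addr.
move=> t [tx tinf]; rewrite leNgt; apply/negP => /word_ltP[n [st ltst]].
have [_] := smax n; move=> /(_ (t n)); rewrite leqNgt ltst.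
rewrite (eq_word_value_shift _ st) ?sx ?tx// word_valueE /shift_word addn0.
rewrite /= ltr_branch lt_neqAle lambda_le andbT orbC.
(* If [t] has remainder [lambda S] after position [n], it continues with zeros only and is finite,
   as [t n > s n]. *)
case: eqVneq => [/esym/(word_value_lambda rS) t0 _|_ /(_ isT)//].
apply: tinf; exists n; split; first exact: leq_ltn_trans ltst.
move=> i ni; have := congr1 (fun u : word M => u (i - n.+1)%N) t0.
by rewrite addnA addn1 subnKC.
Qed.

Lemma expansion_mirror S x t :
  expansion (mirror_system S) (- x) t <-> expansion S x (mirror_word t).
Proof.
rewrite /expansion /= word_value_mirror; split=> [/oppr_inj//|->//].
Qed.

End Regular.

Theorem theorem1p1 (R : realType) (M : nat) (hM : (1 <= M)%N)
    (S : alphabet_base_system R M) (hS : regular S) :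
  (forall x : R, x \notin `[lambda S, Lambda S] ->
     ~ exists s : word M, expansion S x s) /\
  (forall x : R, x \in `[lambda S, Lambda S] ->
     [/\ exists s, largest_in (expansion S x) s,
         exists s, largest_in (expansion S x `&` [set t | infinite_word t]) s,
         exists s, smallest_in (expansion S x) s
       & exists s,
           smallest_in (expansion S x `&` [set t | coinfinite_word t]) s]).
Proof.
split=> x; rewrite in_itv /=.
  by move=> + [s sx]; rewrite -sx lambda_le Lambda_ge.
move=> xlL; have xlL' :
    lambda (mirror_system S) <= - x <= Lambda (mirror_system S).
  by rewrite lambda_mirror Lambda_mirror !lerN2 andbC.
have rS' := regular_mirror hS.
have mirrorE t : expansion S x t -> expansion (mirror_system S) (- x) (mirror_word t).
  by move=> xt; apply/expansion_mirror; rewrite mirror_wordK.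
split.
- exact: largest_expansion.
- exact: largest_infinite_expansion.
- have [s sL] := largest_expansion rS' xlL'.
  exists (mirror_word s); apply: smallest_in_mirror sL => [t|t]; last exact: mirrorE.
  by move=> /expansion_mirror.
(* Mirroring exchanges finite and co-finite words, hence also their complements. *)
- have [s sL] := largest_infinite_expansion rS' xlL'.
  exists (mirror_word s); apply: smallest_in_mirror sL => [t|t] [xt tinf]; split.
  + exact/expansion_mirror.
  + by move=> /finite_mirror_word; rewrite mirror_wordK.
  + exact: mirrorE.
  + by move=> /cofinite_mirror_word; rewrite mirror_wordK.
Qed.
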